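(* Let $H,L,M\in\mathbb{R}^{n\times n}$ and $K\in\mathbb{R}^{m\times m}$ be symmetric positive definite, with $K=E^TE$ for some $E\in\mathbb{R}^{m\times m}$. Let $f:\mathbb{R}^n\to\mathbb{R}\cup\{\infty\}$ be proper, closed and convex, such that $f$ is 1-strongly convex when defined on $\mathbb{H}_H$ and 1-smooth when defined on $\mathbb{H}_L$. Let $\mathcal{A}:\mathbb{H}_M\to\mathbb{H}_K$ be a surjective linear operator and let $A\in\mathbb{R}^{m\times n}$ satisfy $Ax=\mathcal{A}x$ for all $x$. Let $c\in\mathbb{H}_K$ and define $d_1:\mathbb{H}_K\to\mathbb{R}\cup\{\infty\}$ by $$d_1(\mu)=f^*(-\mathcal{A}^*\mu)+\langle c,\mu\rangle_K,$$ where the conjugate $f^*$ is taken with respect to $\langle\cdot,\cdot\rangle_M$ and $\mathcal{A}^*:\mathbb{H}_K\to\mathbb{H}_M$ is the adjoint of $\mathcal{A}$. Then $d_1$, as a function on $\mathbb{H}_K$, is $\|EAH^{-1}A^TE^T\|_2$-smooth and $\lambda_{\min}(EAL^{-1}A^TE^T)$-strongly convex, where $\lambda_{\min}(EAL^{-1}A^TE^T)>0$.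
   Context: For a symmetric positive definite matrix $P$, $\mathbb{H}_P$ denotes the finite-dimensional Hilbert space with inner product $\langle x,y\rangle_P=x^TPy$ and norm $\|x\|_P=\sqrt{x^TPx}$. A function $h$ on $\mathbb{H}_P$ is $\sigma$-strongly convex if $h-\frac{\sigma}{2}\|\cdot\|_P^2$ is convex, and $\beta$-smooth if it is differentiable and $\frac{\beta}{2}\|\cdot\|_P^2-h$ is convex. The conjugate of $f$ on $\mathbb{H}_M$ is $f^*(y)=\sup_x\{\langle y,x\rangle_M-f(x)\}$. $\|\cdot\|_2$ on matrices is the spectral norm and $\lambda_{\min}$ is the smallest eigenvalue. *)

(* Defs.v *)
From mathcomp Require Import all_boot all_order all_algebra.
From mathcomp Require Import all_classical all_reals all_analysis.

Set Implicit Arguments.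
Unset Strict Implicit.
Unset Printing Implicit Defensive.

Import Order.TTheory GRing.Theory Num.Theory.
Import numFieldNormedType.Exports.

Local Open Scope classical_set_scope.
Local Open Scope ring_scope.

(* The space H_P has carrier 'cV[R]_n; its geometry enters through [inner P]
   and [pnorm P].  All norms on 'cV[R]_n being equivalent, closedness and
   differentiability use the library's norm on column vectors. *)

Definition posdef (R : realType) (n : nat) (P : 'M[R]_n) : Prop :=
  P^T = P /\ forall x : 'cV[R]_n, x != 0 -> 0 < (x^T *m P *m x) 0 0.

Definition inner (R : realType) (n : nat) (P : 'M[R]_n) (x y : 'cV[R]_n) : R :=
  (x^T *m P *m y) 0 0.

Definition pnorm (R : realType) (n : nat) (P : 'M[R]_n) (x : 'cV[R]_n) : R :=
  Num.sqrt (inner P x x).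

(* The endpoints t = 0, 1 are left out to avoid products 0 * +oo. *)
Definition convex_fun (R : realType) (n : nat) (h : 'cV[R]_n -> \bar R) : Prop :=
  forall (x y : 'cV[R]_n) (t : R), 0 < t -> t < 1 ->
    (h (t *: x + (1 - t) *: y)%R <= t%:E * h x + (1 - t)%:E * h y)%E.

Definition proper_fun (R : realType) (n : nat) (h : 'cV[R]_n -> \bar R) : Prop :=
  (forall x, (-oo < h x)%E) /\ exists x, (h x < +oo)%E.

Definition epigraph (R : realType) (n : nat) (h : 'cV[R]_n -> \bar R) :
    set ('cV[R]_n * R) :=
  [set p | (h p.1 <= p.2%:E)%E].

Definition closed_fun (R : realType) (n : nat) (h : 'cV[R]_n -> \bar R) : Prop :=
  closed (epigraph h).

Definition strongly_convex (R : realType) (n : nat) (P : 'M[R]_n) (sigma : R)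
    (h : 'cV[R]_n -> \bar R) : Prop :=
  convex_fun (fun x => h x - (sigma / 2 * pnorm P x ^+ 2)%:E)%E.

(* Differentiability of an extended-real-valued function on the whole space
   includes finiteness everywhere. *)
Definition smooth (R : realType) (n : nat) (P : 'M[R]_n) (beta : R)
    (h : 'cV[R]_n -> \bar R) : Prop :=
  [/\ forall x, h x \is a fin_num,
      forall x, differentiable (fun z => fine (h z) : R^o) x
    & convex_fun (fun x => (beta / 2 * pnorm P x ^+ 2)%:E - h x)%E].

Definition conjugate (R : realType) (n : nat) (P : 'M[R]_n)
    (h : 'cV[R]_n -> \bar R) (y : 'cV[R]_n) : \bar R :=
  ereal_sup [set ((inner P y x)%:E - h x)%E | x in [set: 'cV[R]_n]].

(* S : H_Q -> H_P is the adjoint of T : H_P -> H_Q. *)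
Definition is_adjoint (R : realType) (n m : nat) (P : 'M[R]_n) (Q : 'M[R]_m)
    (T : 'cV[R]_n -> 'cV[R]_m) (S : 'cV[R]_m -> 'cV[R]_n) : Prop :=
  forall x y, inner Q (T x) y = inner P x (S y).

Definition spectral_norm (R : realType) (m n : nat) (B : 'M[R]_(m, n)) : R :=
  sup [set pnorm 1%:M (B *m x) | x in [set x : 'cV[R]_n | pnorm 1%:M x <= 1]].

(* There are finitely many eigenvalues, so for a symmetric matrix of positive
   size the infimum is attained. *)
Definition lambda_min (R : realType) (n : nat) (B : 'M[R]_n) : R :=
  inf [set a : R | eigenvalue B a].

(* Main.v *)
From HB Require Import structures.
Require Import Defs.
From mathcomp Require Import all_boot all_order all_algebra.
From mathcomp Require Import all_classical all_reals all_analysis.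
From mathcomp Require Import ring lra.

(** Write [F] for the real-valued function [f], [|x|_P^2] for [inner P x x],
    and let the chord gap of a function [F] be
    [t F x + (1 - t) F y - F (t x + (1 - t) y)].  The chord gap of
    [|.|_P^2 / 2] is exactly [t (1 - t) / 2 * |x - y|_P^2], so 1-strong
    convexity in H_P says that the chord gap is at least this number, and
    1-smoothness gives that it is at most this number.

    In these terms conjugation exchanges the two bounds and inverts the
    matrix.  Let [g u = sup_x (<u, x> - F x)] be the conjugate for the standard
    dot product.
    - If the gap of [F] is at least that of [|.|_H^2 / 2], and [x], [y] are
      maximizers for [u], [v], then testing [t x + (1 - t) y] in the supremum
      at [t u + (1 - t) v] bounds the gap of [g] by
      [t (1 - t) (<u - v, x - y> - |x - y|_H^2 / 2)], which is at most
      [t (1 - t) / 2 * |u - v|_{H^-1}^2] by the Fenchel-Young inequality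
      ([conj_chord_gap_le]).
    - If the gap of [F] is at most that of [|.|_L^2 / 2], and [z] is a maximizer
      for [t u + (1 - t) v], then testing [z + (1 - t) d] at [u] and [z - t d]
      at [v], with [d = L^-1 (u - v)] the equality case of Fenchel-Young, gives
      the reverse bound with [L^-1] ([conj_chord_gap_ge]).

    Maximizers exist because [F] is continuous and, being strongly convex, grows
    quadratically ([conj_attained]).  A maximizer at [u] is a subgradient of [g]
    at [u]; a subgradient together with an upper bound on the chord gap pins [g]
    to an affine function up to a quadratic error, so [g] is differentiable
    ([differentiable_chord_gap_le]).

    Since the adjoint satisfies [M A* = A^T K], one has
    [d1 mu = g (- A^T K mu) + <K c, mu>], so the bounds for [g] in [Q = H^-1] or
    [Q = L^-1] become bounds for [d1] in [K A Q A^T K].  With [K = E^T E] this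
    form at [x] is [E A Q A^T E^T] at [E x], while [|x|_K^2] is the squared
    Euclidean norm of [E x]; what remains is to compare a matrix with its
    spectral norm ([spectral_norm_quad]) and, through a minimizer of the
    Rayleigh quotient, with its smallest eigenvalue ([lambda_minP]). *)

Import Order.TTheory GRing.Theory Num.Theory.
Import numFieldNormedType.Exports.

Local Open Scope classical_set_scope.
Local Open Scope ring_scope.

(** * The form of a matrix and the Fenchel-Young inequality *)

Section Inner.
Set Implicit Arguments. Unset Strict Implicit.
Context (R : realType) (n : nat).
Implicit Types (P Q : 'M[R]_n) (x y z u v : 'cV[R]_n) (a : R).

Lemma innerDl P x y z : inner P (x + y) z = inner P x z + inner P y z.
Proof. by rewrite /inner linearD /= !mulmxDl mxE. Qed.

Lemma innerDr P x y z : inner P z (x + y) = inner P z x + inner P z y.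
Proof. by rewrite /inner mulmxDr mxE. Qed.

Lemma innerZl P a x y : inner P (a *: x) y = a * inner P x y.
Proof. by rewrite /inner linearZ /= -!scalemxAl mxE. Qed.

Lemma innerZr P a x y : inner P x (a *: y) = a * inner P x y.
Proof. by rewrite /inner -scalemxAr mxE. Qed.

Lemma innerNl P x y : inner P (- x) y = - inner P x y.
Proof. by rewrite -scaleN1r innerZl mulN1r. Qed.

Lemma innerNr P x y : inner P x (- y) = - inner P x y.
Proof. by rewrite -scaleN1r innerZr mulN1r. Qed.

Lemma inner0l P y : inner P 0 y = 0.
Proof. by rewrite -(scale0r 0) innerZl mul0r. Qed.


Definition innerE := (innerDl, innerDr, innerNl, innerNr, innerZl, innerZr).

Lemma innerC P x y : P^T = P -> inner P x y = inner P y x.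
Proof.
move=> Ps; rewrite /inner.
have -> : x^T *m P *m y = (y^T *m P *m x)^T by rewrite !trmx_mul Ps trmxK mulmxA.
by rewrite mxE.
Qed.

Lemma innerMZ P a x y : inner (a *: P) x y = a * inner P x y.
Proof. by rewrite /inner -scalemxAr -scalemxAl mxE. Qed.

Lemma innerMB P Q x y : inner (P - Q) x y = inner P x y - inner Q x y.
Proof. by rewrite /inner mulmxBr mulmxBl !mxE. Qed.

Lemma inner1E x y : inner 1%:M x y = \sum_i x i 0 * y i 0.
Proof. by rewrite /inner mulmx1 !mxE; apply: eq_bigr => i _; rewrite !mxE. Qed.

Lemma inner_dot P x y : inner P x y = inner 1%:M x (P *m y).
Proof. by rewrite /inner mulmx1 mulmxA. Qed.

Lemma inner_sum P x y :
  inner P x y = \sum_i \sum_j x i 0 * P i j * y j 0.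
Proof.
rewrite inner_dot inner1E; apply: eq_bigr => i _; rewrite mxE mulr_sumr.
by apply: eq_bigr => j _; rewrite mulrA.
Qed.

Lemma dot_ge0 x : 0 <= inner 1%:M x x.
Proof. by rewrite inner1E sumr_ge0 // => i _; rewrite -expr2 sqr_ge0. Qed.

Lemma dot_eq0 x : inner 1%:M x x = 0 -> x = 0.
Proof.
rewrite inner1E => /psumr_eq0P x0; apply/colP => i; rewrite mxE.
apply/eqP; rewrite -sqrf_eq0 expr2; apply/eqP; apply: x0 => // j _.
by rewrite -expr2 sqr_ge0.
Qed.

Lemma dot_gt0 x : x != 0 -> 0 < inner 1%:M x x.
Proof.
by move=> x0; rewrite lt_neqAle dot_ge0 andbT eq_sym;
  apply: contra x0 => /eqP/dot_eq0/eqP.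
Qed.

Lemma eq_from_dot u v :
  (forall x, inner 1%:M x u = inner 1%:M x v) -> u = v.
Proof.
move=> uv; apply/eqP; rewrite -subr_eq0; apply/eqP/dot_eq0.
by rewrite innerDr innerNr uv subrr.
Qed.

Lemma posdef_ge0 P x : posdef P -> 0 <= inner P x x.
Proof.
move=> [_ P0]; have [->|/P0/ltW //] := eqVneq x 0; by rewrite inner0l.
Qed.

Lemma pnorm_sqr P x : posdef P -> pnorm P x ^+ 2 = inner P x x.
Proof. by move=> Pp; rewrite /pnorm sqr_sqrtr // posdef_ge0. Qed.

(** A vector of the left kernel would have zero norm in H_P. *)
Lemma posdef_unitmx P : posdef P -> P \in unitmx.
Proof.
move=> [Ps Pp]; rewrite unitmxE unitfE; apply/det0P => -[v v0 vP].
have /Pp : v^T != 0 by rewrite -(inj_eq trmx_inj) trmxK trmx0.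
by rewrite trmxK vP mul0mx mxE ltxx.
Qed.

Lemma posdef_invmx P : posdef P -> posdef (invmx P).
Proof.
move=> Pp; have Pu := posdef_unitmx Pp; split.
  by rewrite trmx_inv Pp.1.
move=> x x0; have PK : P *m (invmx P *m x) = x by rewrite mulKVmx.
have y0 : invmx P *m x != 0.
  by apply: contra x0 => /eqP y0; rewrite -PK y0 mulmx0.
have := Pp.2 _ y0; rewrite -/(inner P _ _) -/(inner (invmx P) _ _).
by rewrite inner_dot PK innerC ?trmx1 // -inner_dot.
Qed.

(** The difference of the two sides is half of [|x - P^-1 u|_P^2]. *)
Lemma fenchel_young P u x : posdef P ->
  inner 1%:M u x - inner P x x / 2 <= inner (invmx P) u u / 2.
Proof.
move=> Pp; have Pu := posdef_unitmx Pp; have Ps := Pp.1.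
have := posdef_ge0 (x - invmx P *m u) Pp.
have Puu : P *m (invmx P *m u) = u by rewrite mulmxA mulmxV // mul1mx.
have E1 : inner P (invmx P *m u) x = inner 1%:M u x.
  by rewrite innerC // inner_dot Puu innerC // trmx1.
have E2 : inner P (invmx P *m u) (invmx P *m u) = inner (invmx P) u u.
  by rewrite inner_dot Puu [RHS]inner_dot innerC // trmx1.
have E3 : inner P x (invmx P *m u) = inner 1%:M u x by rewrite innerC.
rewrite !innerE E2 E3 E1; lra.
Qed.

(** Equality in [fenchel_young] holds at [x = P^-1 u]. *)
Lemma fenchel_young_eq P u : posdef P ->
  inner 1%:M u (invmx P *m u) - inner P (invmx P *m u) (invmx P *m u) / 2
  = inner (invmx P) u u / 2.
Proof.
move=> Pp; have Pu := posdef_unitmx Pp.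
have Puu : P *m (invmx P *m u) = u by rewrite mulmxA mulmxV // mul1mx.
rewrite [inner P _ _]inner_dot Puu [inner _ (invmx P *m u) u]innerC ?trmx1 //.
by rewrite -inner_dot; lra.
Qed.

End Inner.

(** * Chord gaps and conjugation *)

Section Chords.
Set Implicit Arguments. Unset Strict Implicit.
Context (R : realType) (n : nat).
Implicit Types (P Q : 'M[R]_n) (x y z u v : 'cV[R]_n) (F g : 'cV[R]_n -> R).

(** Strong convexity and the convexity half of smoothness, without subtraction of
    extended reals and for an arbitrary matrix, so that the modulus, inverse
    matrices and pullbacks are all absorbed into [P]. *)
Definition chord_gap_ge P F := forall x y t, 0 < t -> t < 1 ->
  F (t *: x + (1 - t) *: y) + t * (1 - t) / 2 * inner P (x - y) (x - y)
    <= t * F x + (1 - t) * F y.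

Definition chord_gap_le P F := forall x y t, 0 < t -> t < 1 ->
  t * F x + (1 - t) * F y
    <= F (t *: x + (1 - t) *: y) + t * (1 - t) / 2 * inner P (x - y) (x - y).

Lemma inner_chord P x y t :
  t * inner P x x + (1 - t) * inner P y y
    - inner P (t *: x + (1 - t) *: y) (t *: x + (1 - t) *: y)
  = t * (1 - t) * inner P (x - y) (x - y).
Proof. rewrite !innerE; ring. Qed.

Lemma strongly_convexP P sigma F : posdef P ->
  strongly_convex P sigma (fun x => (F x)%:E) <-> chord_gap_ge (sigma *: P) F.
Proof.
move=> Pp; split=> hF x y t t0 t1; move: (hF x y t t0 t1);
  rewrite -?EFinB -?EFinM -?EFinD ?lee_fin !pnorm_sqr // innerMZ;
  have := inner_chord P x y t; set q := inner P (x - y) _;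
  set a := inner P x x; set b := inner P y y; set c := inner P (_ + _) _;
  move=> E.
all: have -> : t * (1 - t) / 2 * (sigma * q) = sigma / 2 * (t * (1 - t) * q)
  by ring.
all: rewrite -E; lra.
Qed.

Lemma smooth_convexP P beta F : posdef P ->
  convex_fun (fun x => (beta / 2 * pnorm P x ^+ 2)%:E - (F x)%:E)%E <->
  chord_gap_le (beta *: P) F.
Proof.
move=> Pp; split=> hF x y t t0 t1; move: (hF x y t t0 t1);
  rewrite -?EFinB -?EFinM -?EFinD ?lee_fin !pnorm_sqr // innerMZ;
  have := inner_chord P x y t; set q := inner P (x - y) _;
  set a := inner P x x; set b := inner P y y; set c := inner P (_ + _) _;
  move=> E.
all: have -> : t * (1 - t) / 2 * (beta * q) = beta / 2 * (t * (1 - t) * q)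
  by ring.
all: rewrite -E; lra.
Qed.

Lemma chord_gap_ge_mono P Q F : (forall x, inner Q x x <= inner P x x) ->
  chord_gap_ge P F -> chord_gap_ge Q F.
Proof.
move=> QP hF x y t t0 t1; apply: le_trans (hF x y t t0 t1).
rewrite lerD2l ler_wpM2l // divr_ge0 // mulr_ge0 ?ltW // subr_gt0 //.
Qed.

Lemma chord_gap_le_mono P Q F : (forall x, inner P x x <= inner Q x x) ->
  chord_gap_le P F -> chord_gap_le Q F.
Proof.
move=> QP hF x y t t0 t1; apply: le_trans (hF x y t t0 t1) _.
rewrite lerD2l ler_wpM2l // divr_ge0 // mulr_ge0 ?ltW // subr_gt0 //.
Qed.

(** [g] is the conjugate of [F] for the dot product, with every supremum
    attained: the duality estimates are carried out at the maximizers. *)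
Definition attained_conj F g := forall u,
  (forall x, inner 1%:M u x - F x <= g u) /\
  (exists x, g u = inner 1%:M u x - F x).

(** The maximizers at [u] and [v] combine to a test point at
    [t u + (1 - t) v], and Fenchel-Young absorbs the cross term. *)
Lemma conj_chord_gap_le P F g : posdef P -> attained_conj F g ->
  chord_gap_ge P F -> chord_gap_le (invmx P) g.
Proof.
move=> Pp Fg hF u v t t0 t1.
have [_ [x ->]] := Fg u; have [_ [y ->]] := Fg v.
have [/(_ (t *: x + (1 - t) *: y)) hw _] := Fg (t *: u + (1 - t) *: v).
have hc := hF x y t t0 t1.
have c0 : 0 <= t * (1 - t) by rewrite mulr_ge0 ?ltW // subr_gt0.
have := ler_wpM2l c0 (fenchel_young (u - v) (x - y) Pp).
set q := inner P _ _ in hc *; set r := inner (invmx P) _ _.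
move: hw; rewrite !innerE; nra.
Qed.

(** The maximizer [z] at [t u + (1 - t) v] splits into two test points with
    mean [z], moved apart by the vector that makes Fenchel-Young an equality. *)
Lemma conj_chord_gap_ge P F g : posdef P -> attained_conj F g ->
  chord_gap_le P F -> chord_gap_ge (invmx P) g.
Proof.
move=> Pp Fg hF u v t t0 t1.
have [_ [z ->]] := Fg (t *: u + (1 - t) *: v).
pose d := invmx P *m (u - v).
pose x := z + (1 - t) *: d; pose y := z - t *: d.
have [/(_ x) hu _] := Fg u; have [/(_ y) hv _] := Fg v.
have hc := hF x y t t0 t1.
have zE : t *: x + (1 - t) *: y = z by apply/colP => i; rewrite !mxE; ring.
have dE : x - y = d by apply/colP => i; rewrite !mxE; ring.
rewrite zE dE in hc.
have fy := fenchel_young_eq (u - v) Pp; rewrite -/d in fy.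
have -> : t * (1 - t) / 2 * inner (invmx P) (u - v) (u - v)
  = t * (1 - t) * (inner (invmx P) (u - v) (u - v) / 2) by ring.
rewrite -fy; set q := inner P _ _ in hc *.
have hu' := ler_wpM2l (ltW t0) hu.
have t1' : 0 <= 1 - t by rewrite subr_ge0 ltW.
have hv' := ler_wpM2l t1' hv.
move: hu' hv'; rewrite /x /y !innerE -/x -/y; nra.
Qed.

End Chords.

Section Pullback.
Set Implicit Arguments. Unset Strict Implicit.
Context (R : realType) (n m : nat).

Lemma inner_pullback (P : 'M[R]_n) (B : 'M[R]_(n, m)) (x y : 'cV_m) :
  inner (B^T *m P *m B) x y = inner P (B *m x) (B *m y).
Proof. by rewrite /inner trmx_mul !mulmxA. Qed.

Context (P : 'M[R]_n) (F : 'cV[R]_n -> R) (B : 'M[R]_(n, m)) (c : 'cV[R]_m).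

Let affine (x y : 'cV[R]_m) (t : R) :
  B *m (t *: x + (1 - t) *: y) = t *: (B *m x) + (1 - t) *: (B *m y).
Proof. by rewrite mulmxDr -!scalemxAr. Qed.

Lemma chord_gap_ge_pullback : chord_gap_ge P F ->
  chord_gap_ge (B^T *m P *m B) (fun x => F (B *m x) + inner 1%:M c x).
Proof.
move=> hF x y t t0 t1; rewrite inner_pullback mulmxBr affine !innerE.
by have := hF (B *m x) (B *m y) t t0 t1; rewrite !innerE; lra.
Qed.

Lemma chord_gap_le_pullback : chord_gap_le P F ->
  chord_gap_le (B^T *m P *m B) (fun x => F (B *m x) + inner 1%:M c x).
Proof.
move=> hF x y t t0 t1; rewrite inner_pullback mulmxBr affine !innerE.
by have := hF (B *m x) (B *m y) t t0 t1; rewrite !innerE; lra.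
Qed.

End Pullback.

(** * Differentiability and compactness for column vectors *)

(** The differential ['d f u] is defined by choice; an expansion along [df]
    identifies it with [df]. *)
Lemma differentiable_taylor1 (R : numFieldType) (V W : normedModType R)
    (f : V -> W) (df : {linear V -> W}) (u : V) : continuous df ->
  (forall e, 0 < e ->
     \forall h \near 0, `|f (h + u) - f u - df h| <= e * `|h|) ->
  differentiable f u.
Proof.
move=> dfc hf.
have key : f \o shift u = cst (f u) + df +o_ 0 id.
  apply/eqaddoP => e e0; near=> h.
  rewrite [X in `|X|](_ : _ = f (h + u) - f u - df h).
    by near: h; exact: hf.
  by rewrite !fctE /= opprD addrA.
by apply/diff_locallyP; rewrite (diff_unique dfc key).
Unshelve. all: by end_near. Qed.

Lemma trmx_continuous (T : topologicalType) (m n : nat) :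
  continuous (@trmx T m n).
Proof.
move=> x A [P AP sP]; exists (fun i j => P j i) => [i j|N hN].
  by have := AP j i; rewrite mxE.
by apply: sP => i j; rewrite mxE.
Qed.

Section Topology.
Set Implicit Arguments. Unset Strict Implicit.
Context (R : realType) (n : nat).
Implicit Types (P Q : 'M[R]_n) (x y z u v : 'cV[R]_n) (F g : 'cV[R]_n -> R).

Lemma coord_le_norm x i : `|x i 0| <= `|x|.
Proof.
rewrite [leRHS]/Num.norm /= mx_normrE; apply/bigmax_geP; right => /=.
by exists (i, 0).
Qed.

Lemma norm_sqr_le_dot x : `|x| ^+ 2 <= inner 1%:M x x.
Proof.
have [->|x0] := eqVneq `|x| 0; first by rewrite expr0n dot_ge0.
have [[i j] /= xE] := mx_norm_neq0 x0; rewrite (ord1 j) in xE.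
have -> : `|x| = `|x i 0| by exact: xE.
rewrite inner1E (bigD1 i) //= -normrX ger0_norm ?sqr_ge0 // expr2 lerDl.
by rewrite sumr_ge0 // => k _; rewrite -expr2 sqr_ge0.
Qed.

Lemma inner_bounded P : exists2 C, 0 <= C &
  forall x y, `|inner P x y| <= C * (`|x| * `|y|).
Proof.
exists (\sum_i \sum_j `|P i j|).
  by rewrite sumr_ge0 // => i _; rewrite sumr_ge0.
move=> x y; rewrite inner_sum (le_trans (ler_norm_sum _ _ _)) // mulr_suml.
apply: ler_sum => i _; rewrite (le_trans (ler_norm_sum _ _ _)) // mulr_suml.
apply: ler_sum => j _; rewrite !normrM -mulrA mulrCA.
rewrite ler_wpM2l // ler_pM ?coord_le_norm //.
Qed.

Lemma dot_linear u : linear (inner 1%:M u : 'cV[R]_n -> R^o).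
Proof. by move=> a x y; rewrite innerDr innerZr. Qed.

Definition dot_fun u : {linear 'cV[R]_n -> R^o} :=
  HB.pack (inner 1%:M u : 'cV[R]_n -> R^o)
    (GRing.isLinear.Build _ _ _ _ _ (@dot_linear u)).

Lemma dot_continuous u : continuous (dot_fun u).
Proof.
apply/linear_bounded_continuous/bounded_funP => r.
have [C C0 hC] := inner_bounded 1%:M.
exists (C * (`|u| * r)) => x xr; apply: le_trans (hC u x) _.
by rewrite ler_wpM2l // ler_wpM2l.
Qed.

Lemma differentiable_quad F u (s : 'cV[R]_n) (C : R) :
  (forall v, `|F v - F u - inner 1%:M s (v - u)| <= C * `|v - u| ^+ 2) ->
  differentiable (F : 'cV[R]_n -> R^o) u.
Proof.
move=> hF.
apply: (@differentiable_taylor1 R 'cV[R]_n R^o F (dot_fun s)) => [|e e0].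
  exact: dot_continuous.
have C1 : 0 < `|C| + 1 by rewrite ltr_pwDr.
have d0 : 0 < e / (`|C| + 1) by rewrite divr_gt0.
near=> h; have := hF (h + u); rewrite addrK => hh.
apply: le_trans hh _; rewrite expr2 mulrA ler_wpM2r //.
have : `|h| <= e / (`|C| + 1)
  by near: h; exact: (@pseudometric_normed_Zmodule.nbhs0_le R 'cV[R]_n _ d0).
rewrite ler_pdivlMr // => he; apply: le_trans he.
rewrite mulrC ler_wpM2l // (le_trans (ler_norm _)) // lerDl //.
Unshelve. all: by end_near. Qed.

(** The expansion of a quadratic form at [u] is exact up to the form at
    [v - u], so it is differentiable with gradient [(P + P^T) u]. *)
Lemma quad_continuous P : continuous (fun x => inner P x x).
Proof.
move=> u; have [C C0 hC] := inner_bounded P.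
apply: (@differentiable_continuous R _ R^o).
apply: (@differentiable_quad _ _ ((P + P^T) *m u) C) => v.
have -> : inner P v v - inner P u u - inner 1%:M ((P + P^T) *m u) (v - u)
    = inner P (v - u) (v - u).
  rewrite [inner 1%:M _ _]innerC ?trmx1 // -inner_dot.
  have E x y : inner (P + P^T) x y = inner P x y + inner P y x.
    rewrite /inner mulmxDr mulmxDl mxE; congr (_ + _).
    have -> : x^T *m P^T *m y = (y^T *m P *m x)^T
      by rewrite !trmx_mul trmxK mulmxA.
    by rewrite mxE.
  by rewrite E !innerE; ring.
by have := hC (v - u) (v - u); rewrite expr2.
Qed.

(** Transposition carries the Heine-Borel theorem over from row vectors. *)
Lemma cV_bounded_closed_compact (A : set 'cV[R]_n) (r : R) :
  (forall x, A x -> `|x| <= r) -> closed A -> compact A.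
Proof.
move=> Ar Acl.
have -> : A = trmx @` (trmx @^-1` A : set 'rV[R]_n).
  apply/seteqP; split => [x Ax|x [y Ay <-] //].
  by exists x^T => /=; rewrite trmxK.
apply: continuous_compact.
  exact/continuous_subspaceT/trmx_continuous.
apply: bounded_closed_compact.
  exists r; split; first exact: num_real.
  move=> M /ltW rM y /= /Ar yr; apply: le_trans rM; apply: le_trans yr.
  rewrite [leLHS]/Num.norm /= mx_normrE; apply/bigmax_leP; split => // -[i j] _ /=.
  by rewrite (ord1 i); have := coord_le_norm (y^T) j; rewrite mxE.
by apply: closed_comp => // x _; exact: trmx_continuous.
Qed.

(** [x] minimizes the form on the compact Euclidean unit sphere; the inequality
    for every [y] follows by homogeneity. *)
Lemma rayleigh_min P : (0 < n)%N -> exists2 x, inner 1%:M x x = 1 &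
  forall y, inner P x x * inner 1%:M y y <= inner P y y.
Proof.
move=> n0; pose S : set 'cV[R]_n := [set x | inner 1%:M x x = 1].
have Scl : closed S.
  apply: (@closed_comp _ _ (fun x => inner 1%:M x x) [set x | x = 1]) => // x _.
  exact: quad_continuous.
have Sco : compact S.
  apply: (@cV_bounded_closed_compact S 1) => // x /= x1.
  rewrite -(@expr_le1 _ 2) // (le_trans (norm_sqr_le_dot x)) // x1 //.
have S0 : S !=set0.
  exists (delta_mx (Ordinal n0) 0); rewrite /S /= inner1E (bigD1 (Ordinal n0)) //=.
  rewrite !mxE !eqxx mulr1 big1 ?addr0 // => i ni.
  by rewrite !mxE (negbTE ni) mul0r.
have [x] := compact_EVT_min S0 Sco (continuous_subspaceT (@quad_continuous P)).
rewrite inE => x1 xmin; exists x => // y.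
have [->|y0] := eqVneq y 0; first by rewrite !inner0l mulr0.
have d0 := dot_gt0 y0; set d := inner 1%:M y y in d0 *.
have s0 : 0 < Num.sqrt d by rewrite sqrtr_gt0.
have := xmin ((Num.sqrt d)^-1 *: y).
rewrite inE /S /= !innerE -/d mulrA -invfM -expr2 (sqr_sqrtr (ltW d0)).
rewrite mulVf ?gt_eqF // => /(_ erefl).
rewrite mulrA -invfM -expr2 (sqr_sqrtr (ltW d0)).
by rewrite mulrC ler_pdivlMr.
Qed.

(** [h] is the minimum of the Rayleigh quotient; the norm on the left is the
    supremum norm, which is dominated by the Euclidean one. *)
Lemma posdef_coercive P : posdef P ->
  exists2 h, 0 < h & forall x, h * `|x| ^+ 2 <= inner P x x.
Proof.
move=> Pp; have [n0|] := ltnP 0 n; last first.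
  rewrite leqn0 => /eqP n0; exists 1 => // x.
  have -> : x = 0 by apply/colP => -[i i_lt]; exfalso; move: i_lt; rewrite n0.
  by rewrite normr0 expr0n mulr0 inner0l.
have [x x1 hx] := rayleigh_min P n0; exists (inner P x x).
  apply: Pp.2; apply/eqP => x0; move: x1; rewrite x0 inner0l => /esym/eqP.
  by rewrite oner_eq0.
move=> y; apply: le_trans (hx y).
by rewrite ler_wpM2l ?posdef_ge0 // norm_sqr_le_dot.
Qed.

(** The subgradient bounds [F v] from below.  It also bounds [F] from below at the
    reflection [2 u - v] of [v], and the chord from [v] to its reflection has
    midpoint [u], so the gap bound turns this into an upper bound on [F v]. *)
Lemma differentiable_chord_gap_le Q F u s : chord_gap_le Q F ->
  (forall v, F u + inner 1%:M s (v - u) <= F v) ->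
  differentiable (F : 'cV[R]_n -> R^o) u.
Proof.
move=> hF hs; have [C C0 hC] := inner_bounded Q.
apply: (@differentiable_quad _ _ s C) => v.
have h1 := hs v.
have h2 := hs (u - (v - u)).
have half0 : 0 < 2^-1 :> R by rewrite invr_gt0.
have half1 : 2^-1 < 1 :> R by rewrite invf_lt1 // ltr1n.
have := hF v (u - (v - u)) 2^-1 half0 half1.
have -> : 2^-1 *: v + (1 - 2^-1) *: (u - (v - u)) = u.
  by apply/colP => i; rewrite !mxE; field.
have -> : v - (u - (v - u)) = 2 *: (v - u) by apply/colP => i; rewrite !mxE; ring.
have := hC (v - u) (v - u); rewrite -expr2.
rewrite innerZl innerZr => /ler_normlP[_ hc] hm.
set w := v - u in h1 h2 hc hm *; rewrite addrAC subrr add0r innerNr in h2.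
by rewrite ger0_norm; lra.
Qed.

End Topology.

(** * Smallest eigenvalue and spectral norm *)

Section Extremal.
Set Implicit Arguments. Unset Strict Implicit.
Context (R : realType) (n : nat).
Implicit Types (P B : 'M[R]_n) (x y : 'cV[R]_n).

(** With [z = P x] and [p = |z|^2], the form at [x - s z] is [- 2 s p + O(s^2)],
    which is negative for small [s > 0] unless [p = 0]. *)
Lemma psd_kernel P x : P^T = P -> (forall y, 0 <= inner P y y) ->
  inner P x x = 0 -> P *m x = 0.
Proof.
move=> Ps P0 x0; apply: dot_eq0; set z := P *m x.
have xz : inner P x z = inner 1%:M z z by rewrite innerC // inner_dot.
set p := inner 1%:M z z in xz *; set q := inner P z z.
have q0 : 0 <= q by exact: P0.
(* This [s] is at most [p / q] for [q] the form at [z]; adding 1 avoids dividing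
   by zero. *)
have := P0 (x - (p / (q + 1)) *: z).
have zx : inner P z x = p by rewrite innerC.
rewrite !innerE x0 xz zx -/q.
have q1 : q + 1 != 0 by rewrite gt_eqF // ltr_wpDl.
rewrite [X in 0 <= X](_ : _ = - (p ^+ 2 * ((q + 2) / (q + 1) ^+ 2)));
  last by field.
rewrite oppr_ge0 pmulr_lle0; last by rewrite divr_gt0 ?exprn_gt0 // ltr_wpDl.
by rewrite le_eqVlt ltNge sqr_ge0 orbF sqrf_eq0 => /eqP.
Qed.

(** If [a] is the minimum of the Rayleigh quotient, a minimizer [x] lies in the
    kernel of the positive semidefinite matrix [B - a], so [a] is an eigenvalue; every eigenvalue is a
    Rayleigh quotient, hence at least [a]. *)
Lemma lambda_minP B : (0 < n)%N -> B^T = B ->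
  exists2 x, inner 1%:M x x = 1 & lambda_min B = inner B x x /\
    forall y, lambda_min B * inner 1%:M y y <= inner B y y.
Proof.
move=> n0 Bs; have [x x1 xmin] := rayleigh_min B n0; exists x => //.
suff -> : lambda_min B = inner B x x by [].
set a := inner B x x in xmin *.
have aB : eigenvalue B a.
  have sD y : inner (B - a%:M) y y = inner B y y - a * inner 1%:M y y.
    by rewrite innerMB -(scalemx1 n a) innerMZ.
  have kx : (B - a%:M) *m x = 0.
    apply: (@psd_kernel (B - a%:M)).
    - by rewrite linearB /= Bs tr_scalar_mx.
    - by move=> y; rewrite sD subr_ge0.
    - by rewrite sD x1 mulr1 subrr.
  apply/eigenvalueP; exists x^T.
    rewrite -[x^T *m B]trmxK trmx_mul trmxK Bs; move/eqP: kx.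
    by rewrite mulmxBl subr_eq0 mul_scalar_mx => /eqP ->; rewrite linearZ.
  apply/eqP => xt0; move: x1; rewrite -[x]trmxK xt0 trmx0 inner0l.
  by move/esym/eqP; rewrite oner_eq0.
have lb : lbound [set b : R | eigenvalue B b] a.
  move=> b /= /eigenvalueP [v vB v0].
  have v0' : v^T != 0 by rewrite -(inj_eq trmx_inj) trmxK trmx0.
  have := xmin v^T; rewrite {2}/inner trmxK vB -scalemxAl mxE => h.
  move: h; rewrite [X in _ <= b * X](_ : _ = inner 1%:M v^T v^T); last first.
    by rewrite /inner trmxK mulmx1.
  by rewrite ler_pM2r // dot_gt0.
apply/eqP; rewrite eq_le; apply/andP; split.
  by apply: ge_inf => //; exists a.
by apply: lb_le_inf => //; exists a.
Qed.

Lemma dot_le_pnorm x y : inner 1%:M x x = 1 -> inner 1%:M x y <= pnorm 1%:M y.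
Proof.
move=> x1; rewrite /pnorm (le_trans (ler_norm _)) // -sqrtr_sqr ler_sqrt ?dot_ge0 //.
have := dot_ge0 (y - inner 1%:M x y *: x).
have yx : inner 1%:M y x = inner 1%:M x y by rewrite innerC ?trmx1.
by rewrite !innerE yx x1 expr2; lra.
Qed.

Lemma pnorm1_sqr x : pnorm 1%:M x ^+ 2 = inner 1%:M x x.
Proof. by rewrite /pnorm sqr_sqrtr // dot_ge0. Qed.

Lemma pnorm_ge0 P x : 0 <= pnorm P x.
Proof. exact: sqrtr_ge0. Qed.

Lemma spectral_norm_ge B x :
  pnorm 1%:M x <= 1 -> pnorm 1%:M (B *m x) <= spectral_norm B.
Proof.
move=> x1; apply: ub_le_sup; last by exists x.
have [C C0 hC] := inner_bounded (B^T *m 1%:M *m B).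
exists (Num.sqrt C) => _ [y /= y1 <-].
rewrite /pnorm ler_sqrt // -inner_pullback (le_trans (ler_norm _)) //.
rewrite (le_trans (hC y y)) // -expr2 ler_piMr // (le_trans (norm_sqr_le_dot y)) //.
by rewrite -pnorm1_sqr expr_le1 ?pnorm_ge0.
Qed.

(** Cauchy-Schwarz for [x] and [B x], after normalizing [x]. *)
Lemma spectral_norm_quad B x :
  inner B x x <= spectral_norm B * inner 1%:M x x.
Proof.
have [->|x0] := eqVneq x 0; first by rewrite !inner0l mulr0.
have d0 := dot_gt0 x0; set d := inner 1%:M x x in d0 *.
have s0 : 0 < Num.sqrt d by rewrite sqrtr_gt0.
pose y := (Num.sqrt d)^-1 *: x.
have y1 : inner 1%:M y y = 1.
  rewrite !innerE -/d mulrA -invfM -expr2 (sqr_sqrtr (ltW d0)) mulVf //.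
  by rewrite gt_eqF.
have : inner B y y <= spectral_norm B.
  rewrite inner_dot (le_trans (dot_le_pnorm _ y1)) // spectral_norm_ge //.
  by rewrite /pnorm y1 sqrtr1.
rewrite !innerE mulrA -invfM -expr2 (sqr_sqrtr (ltW d0)).
by rewrite mulrC ler_pdivrMr.
Qed.

End Extremal.

(** * Attainment of the conjugate *)

Section Attainment.
Set Implicit Arguments. Unset Strict Implicit.
Context (R : realType) (n : nat).
Implicit Types (P : 'M[R]_n) (F g : 'cV[R]_n -> R).

(** Near 0 the differentiable function [F] lies above a cone
    [F 0 - k |.|].  Since [F] at [t x] is below the chord from 0 to [x] by at
    least [t (1 - t) / 2 * |x|_P^2], a small [t > 0] carries the cone bound from
    [t x] to [x], with a quadratic gain. *)
Lemma chord_gap_ge_growth P F : posdef P -> chord_gap_ge P F ->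
  differentiable (F : 'cV[R]_n -> R^o) 0 ->
  exists k, forall x, F 0 - k * `|x| + inner P x x / 4 <= F x.
Proof.
move=> Pp hF dF; have /diff_locallyP[dc /eqaddoP/(_ 1 ltr01)] := dF.
have [k k0 hk] := linear_lipschitz dc.
move=> near0; exists (k + 1) => x.
have loc : \forall h \near (0 : 'cV[R]_n), F 0 - (k + 1) * `|h| <= F h.
  near=> h.
  have : `|F h - F 0 - 'd (F : 'cV[R]_n -> R^o) 0 h| <= 1 * `|h|.
    by near: h; apply: filterS near0 => h /=; rewrite !fctE /= addr0 opprD addrA.
  have := hk h; rewrite mul1r => /ler_normlP[h1 h2] /ler_normlP[h3 h4].
  by lra.
have xcvg : (fun t : R => t *: x) @ 0 --> (0 : 'cV[R]_n).
  by rewrite -[X in _ --> X](scale0r x); exact: scalel_continuous.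
have /= loc' := xcvg _ loc.
(* Any [t <= 1/2] gives the gain 1/4, as then [(1 - t) / 2 >= 1/4]. *)
near (0 : R)^'+ => t.
have t0 : 0 < t by [].
have t2 : t < 2^-1 by near: t; apply: nbhs_right_lt; rewrite invr_gt0.
have ht : F 0 - (k + 1) * `|t *: x| <= F (t *: x).
  by near: t; apply: cvg_within; exact: loc'.
have t1 : t < 1 by lra.
have := hF x 0 t t0 t1; rewrite scaler0 addr0 subr0.
rewrite normrZ (ger0_norm (ltW t0)) in ht.
have q0 := posdef_ge0 x Pp; set q := inner P x x in q0 * => hc.
rewrite -(ler_pM2l t0); have : t * (1/2 - t) * q >= 0.
  by rewrite !mulr_ge0 ?(ltW t0) //; lra.
lra.
Unshelve. all: by end_near. Qed.

(** By quadratic growth, the points that do at least as well as 0 form a compact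
    set. *)
Lemma conj_attained P F : posdef P -> chord_gap_ge P F ->
  (forall x, differentiable (F : 'cV[R]_n -> R^o) x) ->
  forall u, exists x, forall y, inner 1%:M u y - F y <= inner 1%:M u x - F x.
Proof.
move=> Pp hF dF u.
have [k hk] := chord_gap_ge_growth Pp hF (dF 0).
have [h h0 hh] := posdef_coercive Pp.
have [C C0 hC] := inner_bounded (1%:M : 'M[R]_n).
pose G y := inner 1%:M u y - F y.
have Gc : continuous G.
  move=> y; apply: (@continuousB R R^o).
    exact: dot_continuous.
  exact: (@differentiable_continuous R _ R^o _ _ (dF y)).
pose S := [set y | G 0 <= G y].
have Scl : closed S.
  apply: (@closed_comp _ _ G [set x | G 0 <= x]); last exact: closed_ge.
  by move=> y _; exact: Gc.
(* On [S] the growth bound reads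
   [h / 4 * |y|^2 <= (C |u| + k) |y|]. *)
pose r := Num.max 0 (4 * (C * `|u| + k) / h).
have Sr y : S y -> `|y| <= r.
  rewrite /S /G /= innerC ?trmx1 // inner0l sub0r => Sy.
  have [->|y0] := eqVneq y 0; first by rewrite normr0 le_max lexx.
  have ny : 0 < `|y| by rewrite normr_gt0.
  rewrite le_max; apply/orP; right; rewrite ler_pdivlMr // -(ler_pM2r ny).
  have := hk y; have := hh y; have /ler_normlP[_] := hC u y.
  rewrite expr2; lra.
have S0 : S !=set0 by exists 0; rewrite /S /=.
have [x] := compact_EVT_max S0 (cV_bounded_closed_compact Sr Scl)
  (continuous_subspaceT Gc).
rewrite inE => Sx xmax; exists x => y.
have [Sy|/ltW Sy] := leP (G 0) (G y); first by apply: xmax; rewrite inE.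
exact: le_trans Sy Sx.
Qed.

Lemma attained_conj_exists P F : posdef P -> chord_gap_ge P F ->
  (forall x, differentiable (F : 'cV[R]_n -> R^o) x) ->
  exists g, attained_conj F g.
Proof.
move=> Pp hF dF; have [xb hxb] := choice (conj_attained Pp hF dF).
exists (fun u => inner 1%:M u (xb u) - F (xb u)) => u.
by split; [exact: hxb|exists (xb u)].
Qed.

End Attainment.

(** * The dual function *)

Section Dual.
Set Implicit Arguments. Unset Strict Implicit.
Context (R : realType) (n : nat).

Lemma adjoint_mx m (M : 'M[R]_n) (K : 'M[R]_m) (A : 'M[R]_(m, n)) T S :
  (forall x, A *m x = T x) -> is_adjoint M K T S ->
  forall mu, M *m S mu = A^T *m K *m mu.
Proof.
move=> AT TS mu; apply: eq_from_dot => x.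
by rewrite -inner_dot -TS -AT /inner mulmx1 trmx_mul !mulmxA.
Qed.

(** As [M] is symmetric, conjugation in H_M is conjugation for the dot product
    precomposed with [M]. *)
Lemma conjugateE (M : 'M[R]_n) (f : 'cV[R]_n -> \bar R) (F g : 'cV[R]_n -> R) :
  M^T = M -> (forall x, f x = (F x)%:E) -> attained_conj F g ->
  forall y, conjugate M f y = (g (M *m y))%:E.
Proof.
move=> Ms fF Fg y; have [gub [x gx]] := Fg (M *m y).
have E z : inner M y z = inner 1%:M (M *m y) z.
  by rewrite innerC // inner_dot innerC ?trmx1.
apply/eqP; rewrite eq_le; apply/andP; split.
  by apply: ub_ereal_sup => _ [z _ <-]; rewrite fF -EFinB lee_fin E.
by apply: ereal_sup_ubound; exists x => //; rewrite fF -EFinB gx E.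
Qed.

End Dual.

Theorem proposition5 (R : realType) (n m : nat) (m_gt0 : (0 < m)%N)
    (H L M : 'M[R]_n) (K E : 'M[R]_m)
    (H_pd : posdef H) (L_pd : posdef L) (M_pd : posdef M) (K_pd : posdef K)
    (KE : K = E^T *m E)
    (f : 'cV[R]_n -> \bar R)
    (f_proper : proper_fun f) (f_closed : closed_fun f) (f_convex : convex_fun f)
    (f_strong : strongly_convex H 1 f) (f_smooth : smooth L 1 f)
    (calA : {linear 'cV[R]_n -> 'cV[R]_m})
    (calA_surj : forall y, exists x, calA x = y)
    (calA_adj : 'cV[R]_m -> 'cV[R]_n)
    (calA_adjP : is_adjoint M K calA calA_adj)
    (A : 'M[R]_(m, n)) (A_calA : forall x, A *m x = calA x)
    (c : 'cV[R]_m)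
    (d1 : 'cV[R]_m -> \bar R)
    (d1E : forall mu,
       d1 mu = (conjugate M f (- calA_adj mu)%R + (inner K c mu)%:E)%E) :
  [/\ smooth K
        (spectral_norm (E *m A *m invmx H *m A^T *m E^T)) d1,
      strongly_convex K
        (lambda_min (E *m A *m invmx L *m A^T *m E^T)) d1
    & 0 < lambda_min (E *m A *m invmx L *m A^T *m E^T)].
Proof.
have [f_fin f_diff f_chord] := f_smooth.
pose F x := fine (f x).
have fF x : f x = (F x)%:E by rewrite fineK.
have fE : f = (fun x => (F x)%:E) by exact/funext.
have F_above : chord_gap_ge H F.
  by move: f_strong; rewrite fE strongly_convexP // scale1r.
have F_below : chord_gap_le L F.
  by move: f_chord; rewrite fE smooth_convexP // scale1r.
have [g Fg] := attained_conj_exists H_pd F_above f_diff.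
pose B := - (A^T *m K).
pose D mu := g (B *m mu) + inner 1%:M (K *m c) mu.
have d1D : d1 = (fun mu => (D mu)%:E).
  apply/funext => mu; rewrite d1E (conjugateE M_pd.1 fF Fg) -EFinD /D.
  rewrite mulmxN (adjoint_mx A_calA calA_adjP) mulNmx.
  by rewrite [inner K c mu]innerC ?K_pd.1 // inner_dot [inner 1%:M mu _]innerC ?trmx1.
have D_below :=
  chord_gap_le_pullback B (K *m c) (conj_chord_gap_le H_pd Fg F_above).
have D_above :=
  chord_gap_ge_pullback B (K *m c) (conj_chord_gap_ge L_pd Fg F_below).
pose G Q := E *m A *m Q *m A^T *m E^T.
(* The form of [Q] pulled back along [B] is [E A Q A^T E^T] seen through [E]. *)
have BG Q x : inner (B^T *m Q *m B) x x = inner (G Q) (E *m x) (E *m x).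
  rewrite -inner_pullback; congr (inner _ x x).
  have -> : B^T = - (K *m A) by rewrite /B linearN /= trmx_mul trmxK K_pd.1.
  by rewrite /B /G mulmxN !mulNmx opprK KE !mulmxA.
have KN x : inner K x x = inner 1%:M (E *m x) (E *m x).
  by rewrite -inner_pullback mulmx1 -KE.
have E_unit : E^T \in unitmx.
  by have := posdef_unitmx K_pd; rewrite KE unitmx_mul => /andP[].
have G_pd : posdef (G (invmx L)).
  have Li := posdef_invmx L_pd; split.
    by rewrite /G !trmx_mul !trmxK Li.1 !mulmxA.
  (* [A^T] is injective because [A] is surjective, and [E] is invertible. *)
  move=> z z0; rewrite -/(inner _ z z).
  have -> : inner (G (invmx L)) z z
      = inner (invmx L) (A^T *m (E^T *m z)) (A^T *m (E^T *m z)).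
    by rewrite mulmxA -inner_pullback trmx_mul !trmxK /G !mulmxA.
  apply: Li.2; apply: contra z0 => /eqP Aw.
  have [x xw] := calA_surj (E^T *m z).
  have /dot_eq0 w0 : inner 1%:M (E^T *m z) (E^T *m z) = 0.
    rewrite -{1}xw -A_calA /inner mulmx1 trmx_mul -mulmxA Aw mulmx0 mxE //.
  by rewrite -(mulKmx E_unit z) w0 mulmx0.
have [z z1 [lam_z lam_min]] := lambda_minP m_gt0 G_pd.1.
split.
- split=> [mu|mu|]; first by rewrite d1D.
  (* A maximizer [x] of the conjugate at [B mu] gives the subgradient
     [B^T x + K c] of [d1] at [mu]. *)
  + rewrite d1D; have [_ [x gx]] := Fg (B *m mu).
    apply: (@differentiable_chord_gap_le _ _ _ _ _ (B^T *m x + K *m c) D_below).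
    move=> nu.
    have [/(_ x) gnu _] := Fg (B *m nu).
    have BT v : inner 1%:M (B^T *m x) v = inner 1%:M (B *m v) x.
      by rewrite innerC ?trmx1 // /inner !mulmx1 trmx_mul mulmxA.
    rewrite innerDl BT mulmxBr !innerE /=; move: gx gnu; lra.
  + rewrite d1D; apply/smooth_convexP => //.
    apply: chord_gap_le_mono D_below => x.
    by rewrite BG innerMZ KN spectral_norm_quad.
- rewrite d1D; apply/strongly_convexP => //.
  apply: chord_gap_ge_mono D_above => x.
  by rewrite BG innerMZ KN; exact: lam_min.
rewrite lam_z; apply: G_pd.2; apply/eqP => z0.
by move: z1; rewrite z0 inner0l => /esym/eqP; rewrite oner_eq0.
Qed.
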